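(* For every $t\in[1,\infty)$, the set $\{\alpha\in\mathbb{R}\setminus\mathbb{Q}:\tau(\alpha)=t\}$ is $\mathbf{\Pi}^0_3$-complete; in other words, it is a $\mathbf{\Pi}^0_3$ subset of $\mathbb{R}\setminus\mathbb{Q}$ that does not belong to $\mathbf{\Sigma}^0_3(\mathbb{R}\setminus\mathbb{Q})$. The set $\{\alpha\in\mathbb{R}\setminus\mathbb{Q}:\tau(\alpha)=\infty\}$ is $\mathbf{\Pi}^0_2$-complete.
   Context: For real $x$, $\|x\|:=\min_{n\in\mathbb{Z}}|x-n|$ denotes the distance from $x$ to the nearest integer. For an irrational real number $\alpha$, the type of $\alpha$ is $$\tau(\alpha):=\sup\big\{\theta\in\mathbb{R}:\liminf_{q\to\infty,\ q\in\mathbb{N}} q^\theta\|q\alpha\|=0\big\}\in[1,\infty].$$ The space $\mathbb{R}\setminus\mathbb{Q}$ carries the topology inherited from $\mathbb{R}$; it is a zero-dimensional Polish space. The classes $\mathbf{\Sigma}^0_\xi,\mathbf{\Pi}^0_\xi$ are those of the Borel hierarchy ($\mathbf{\Sigma}^0_1$ = open sets, $\mathbf{\Pi}^0_\xi$ = complements of $\mathbf{\Sigma}^0_\xi$ sets, and for $\xi>1$, $\mathbf{\Sigma}^0_\xi$ = countable unions of sets each in $\mathbf{\Pi}^0_{\xi'}$ for some $\xi'<\xi$). For a class $\mathbf{\Gamma}$ of sets in Polish spaces and a Polish space $Y$, a subset $B\subset Y$ is $\mathbf{\Gamma}$-complete if $B\in\mathbf{\Gamma}(Y)$ and, for every zero-dimensional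 Polish space $X$ (i.e. one having a basis of clopen sets) and every $A\in\mathbf{\Gamma}(X)$, there is a continuous map $f:X\to Y$ with $f^{-1}(B)=A$. *)

(* Defs.v *)
From HB Require Import structures.
From mathcomp Require Import all_boot all_order all_algebra.
From mathcomp Require Import all_classical all_reals all_analysis.

Set Implicit Arguments.
Unset Strict Implicit.
Unset Printing Implicit Defensive.

Import Order.TTheory GRing.Theory Num.Theory.
Import numFieldNormedType.Exports.

Local Open Scope classical_set_scope.
Local Open Scope ring_scope.

(* The set is nonempty and bounded below, and its infimum is attained. *)
Definition dist_int (R : realType) (x : R) : R :=
  inf [set `|x - n%:~R| | n in [set: int]].

(* [set_type] carries the topology induced by the inclusion into [R]. *)
Definition irrationals (R : realType) : topologicalType :=
  set_type (@irrational R).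

(* The term at [q = 0] does not affect the limit inferior. *)
Definition irr_type (R : realType) (a : irrationals R) : \bar R :=
  ereal_sup [set theta%:E | theta in [set theta : R |
    limn_einf (fun q : nat =>
      (q%:R `^ theta * dist_int (q%:R * set_val a))%:E) = 0%E]].

(* Finite levels of the Borel hierarchy, numbered from 1: [Sigma0 0] is empty.
   Membership of [F i] in the class Pi at level [m i] is spelled out as
   [Sigma0 (m i) (~` F i)]. *)
Inductive Sigma0 (T : topologicalType) : nat -> set T -> Prop :=
| Sigma0_open (U : set T) : open U -> Sigma0 1 U
| Sigma0_bigcup (n : nat) (m : nat -> nat) (F : nat -> set T) :
    (1 < n)%N -> (forall i, (0 < m i < n)%N) ->
    (forall i, Sigma0 (m i) (~` F i)) ->
    Sigma0 n (\bigcup_i F i).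

Definition Pi0 (n : nat) (T : topologicalType) (A : set T) : Prop :=
  Sigma0 n (~` A).

Definition separable (T : topologicalType) : Prop :=
  exists2 D : set T, countable D & dense D.

(* Completeness is stated with filters rather than with the library's
   [completeType], whose spaces are pointed: the empty space is Polish. *)
Definition completely_metrizable (R : realType) (T : topologicalType) : Prop :=
  exists (M : metricType R) (f : T -> M) (g : M -> T),
    [/\ cancel f g, cancel g f, continuous f, continuous g &
        forall F : set_system M, ProperFilter F -> cauchy F ->
          exists l : M, F --> l].

Definition polish (R : realType) (T : topologicalType) : Prop :=
  separable T /\ completely_metrizable R T.

(* Stronger in general than the library's [zero_dimensional], which only
   separates points by clopen sets. *)
Definition has_clopen_basis (T : topologicalType) : Prop :=
  exists2 B : set (set T), basis B & B `<=` clopen.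

Definition class_complete (R : realType)
    (Gamma : forall T : topologicalType, set T -> Prop)
    (Y : topologicalType) (B : set Y) : Prop :=
  Gamma Y B /\
  forall X : topologicalType, polish R X -> has_clopen_basis X ->
  forall A : set X, Gamma X A ->
  exists2 f : X -> Y, continuous f & f @^-1` B = A.

(* Main.v *)
Require Import Defs.
From mathcomp Require Import all_boot all_order all_algebra.
From mathcomp Require Import all_classical all_reals all_analysis.
From mathcomp Require Import ring lra zify.
Import Order.TTheory GRing.Theory Num.Theory.
Import numFieldNormedType.Exports.
Set Implicit Arguments.
Unset Strict Implicit.
Local Open Scope classical_set_scope.
Local Open Scope ring_scope.

(** Call a real [x] approximable at the exponent [s] if [q ^ s * |q x - p| < 1]
    for infinitely many denominators [q]. The type of [x] is the threshold of
    these exponents ([irr_type_ge], [lt_irr_type]), and for fixed [s] the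
    condition defines a countable intersection of open sets. So
    [irr_type a >= t], as well as [irr_type a = +oo], is an intersection of
    countably many open conditions, while [irr_type a > t] is a countable union
    of such intersections. This bounds the Borel class of the level sets
    ([Pi0_3_irr_type_eq], [Pi0_2_irr_type_inf]).

    For the hardness part, prescribed exponents [w n >= 1] are turned into an
    irrational number whose type is the upper limit of [w]: as in a continued
    fraction, consecutive fractions [p n / q n] have determinant [1] or [-1],
    and the denominators are made to grow like
    [q n.+1 ~ (q n) ^ w n]. Then [q n] approximates with exponent about [w n],
    and any other denominator does essentially no better than the [q n] before
    it ([chain_limit_good], [chain_limit_bad]). If each exponent is a locally
    constant function of a parameter, the number depends continuously on the
    parameter, since the first [n] exponents determine it up to [2 / 2 ^ n]
    ([real_of_exponents_local]).

    A set of the second multiplicative class in a zero-dimensional Polish space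
    is [\bigcap_k \bigcup_j C k j] with [C k j] clopen. The number of initial
    conditions that are confirmed after [n] tests ([progress]) is locally
    constant in the point, and it is unbounded in [n] precisely on the set; used
    as an exponent it reduces the set to [irr_type a = +oo]
    ([reduction_inf]). The complement of a set of the third multiplicative class
    is a countable union of such sets, numbered by [i]. Let the exponent at time
    [n] be [t + 1 / (i + 1)] with [i] the least number below [n] that makes
    progress at time [n], or [n] if there is none ([active]). A point lies in the union exactly when some [i] makes progress
    infinitely often, that is, when the upper limit of its exponents exceeds [t]
    ([reduction_finite]).

    Finally the Cantor space has, by diagonalization, a set of the third
    multiplicative class that is not of the third additive class
    ([diagonal_not_Sigma0_3]). It is a continuous preimage of
    [irr_type a = t], and preimages preserve additive classes, so that level set
    is not of the third additive class. *)

(** * Approximation exponents and the type *)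

Lemma exists_double_invn_le (R : realType) (e : R) : 0 < e ->
  exists n, n.+1%:R^-1 + n.+1%:R^-1 <= e.
Proof.
move=> e0; exists (Num.truncn (2 / e)); set n := Num.truncn _.
have : 2 / e < n.+1%:R := truncnS_gt _; rewrite ltr_pdivrMr// => h.
have : n.+1%:R^-1 <= e / 2 by rewrite -div1r ler_pdivrMr//; lra.
by move=> h2; rewrite [leRHS]splitr lerD.
Qed.

Lemma exists_invn_lt (R : realType) (e : R) : 0 < e -> exists n, n.+1%:R^-1 < e.
Proof.
move=> e0; have [n ne] := exists_double_invn_le e0; exists n.
by apply: lt_le_trans ne; rewrite ltrDl invr_gt0.
Qed.

Lemma near_forall_lt (X : topologicalType) (P : nat -> X -> Prop) (x : X) n :
  (forall i, \forall y \near x, P i y) ->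
  \forall y \near x, forall i, (i < n)%N -> P i y.
Proof.
move=> h; elim: n => [|n IH]; first exact: nearW.
apply: filterS2 (h n) IH => y yn IH i; rewrite ltnS leq_eqVlt.
by move=> /orP[/eqP ->|/IH].
Qed.

Section DistInt.
Variable R : realType.
Implicit Types x c : R.

Lemma dist_int_nonempty x : [set `|x - n%:~R| | n in [set: int]] !=set0.
Proof. by exists `|x - 0%:~R|, 0. Qed.

Lemma dist_int_lb x : has_lbound [set `|x - n%:~R| | n in [set: int]].
Proof. by exists 0 => _ [n _ <-]. Qed.

Lemma dist_int_le x (n : int) : dist_int x <= `|x - n%:~R|.
Proof. by apply: ge_inf; [exact: dist_int_lb | exists n]. Qed.

Lemma le_dist_int x c :
  (forall n : int, c <= `|x - n%:~R|) -> c <= dist_int x.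
Proof.
by move=> h; apply: lb_le_inf; [exact: dist_int_nonempty | move=> _ [n _ <-]].
Qed.

Lemma dist_int_ge0 x : 0 <= dist_int x.
Proof. exact: le_dist_int. Qed.

Lemma dist_int_lt x c : dist_int x < c -> exists n : int, `|x - n%:~R| < c.
Proof.
move=> h; apply: contrapT => nh; move: h; apply/negP; rewrite -leNgt.
by apply: le_dist_int => n; rewrite leNgt; apply/negP => h; apply: nh; exists n.
Qed.

End DistInt.

Section IrrationalityType.
Variable R : realType.

Definition approximable_beyond (s : R) (N : nat) : set R :=
  [set x | exists q, [/\ (N < q)%N & exists p : int,
     q%:R `^ s * `|q%:R * x - p%:~R| < 1 :> R]].

(** This replaces the limit inferior in the definition of the type: the type
    of [x] is the threshold of the exponents at which [x] is approximable, up
    to the value at the threshold itself, and the condition is visibly a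
    countable intersection of open ones. *)
Definition approximable (s : R) : set R :=
  [set x | forall N, approximable_beyond s N x].

(** The tail infima of a nonnegative sequence are nonnegative and nondecreasing,
    so their limit vanishes only if each of them does. *)
Lemma limn_einf_eq0 (u : nat -> R) : (forall q, 0 <= u q) ->
  (limn_einf (fun q => (u q)%:E) = 0%E) <->
  (forall (e : R) N, 0 < e -> exists2 q, (N < q)%N & u q < e).
Proof.
move=> u0; set v := fun q => (u q)%:E.
have lE : limn_einf v = ereal_sup (range (einfs v)).
  by rewrite limn_einf_lim; apply/cvg_lim => //; exact: cvg_einfs_sup.
have einfs_ge0 n : (0 <= einfs v n)%E.
  by apply/ereal_infP => _ [m /= _ <-]; rewrite lee_fin.
rewrite lE; split => [l0 e N e0|h].
  apply: contrapT => nh.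
  have : (e%:E <= einfs v N.+1)%E.
    apply/ereal_infP => _ [m /= nm <-]; rewrite lee_fin leNgt; apply/negP => me.
    by apply: nh; exists m.
  apply/negP; rewrite -ltNge (@le_lt_trans _ _ 0%E) ?lte_fin// -l0.
  by apply: ereal_sup_ubound; exists N.+1.
apply/eqP; rewrite eq_le; apply/andP; split; last first.
  by apply: le_trans (einfs_ge0 0) _; apply: ereal_sup_ubound; exists 0%N.
apply/ereal_supP => _ [n _ <-]; apply/lee_addgt0Pr => e e0; rewrite add0e.
have [q nq uq] := h e n e0.
apply: (@le_trans _ _ (v q)); last by rewrite lee_fin ltW.
by apply: ereal_inf_lbound; exists q => //=; exact: ltnW.
Qed.

(** For [d > 0] the bound [q ^ s * |q a - p| < 1] gives
    [q ^ (s - d) * |q a - p| < q ^ (- d)], which tends to [0] along the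
    approximating denominators; hence [s - d] lies in the set whose supremum
    is the type. *)
Lemma irr_type_ge (a : irrationals R) s :
  approximable s (set_val a) -> (s%:E <= irr_type a)%E.
Proof.
move=> h; apply/lee_subgt0Pr => d d0; rewrite -EFinB.
apply: ereal_sup_ubound; exists (s - d) => //=.
apply/limn_einf_eq0 => [q|e N e0].
  by rewrite mulr_ge0 ?powR_ge0 ?dist_int_ge0.
(* Beyond [M] the factor [q ^ d] exceeds [e^-1]. *)
pose M := Num.truncn (e `^ (- d^-1)).
have [q [Nq [p hq]]] := h (maxn N M).
have Nq' : (N < q)%N by rewrite (leq_ltn_trans _ Nq)// leq_maxl.
have q0 : 0 < q%:R :> R by rewrite ltr0n (leq_ltn_trans _ Nq').
exists q => //.
have qe : e^-1 <= q%:R `^ d.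
  have : e `^ (- d^-1) <= q%:R.
    rewrite ltW// (lt_le_trans (truncnS_gt _))// ler_nat.
    by rewrite (leq_ltn_trans _ Nq)// leq_maxr.
  move/(ge0_ler_powR (ltW d0)); rewrite !nnegrE powR_ge0 ltW// => /(_ isT isT).
  by rewrite -powRrM mulNr mulVf ?gt_eqF// powR_inv1// ltW.
rewrite powRB ?(gt_eqF q0) ?implybT//.
apply: (@le_lt_trans _ _ (q%:R `^ s / q%:R `^ d * `|q%:R * set_val a - p%:~R|)).
  by rewrite ler_wpM2l ?dist_int_le// divr_ge0 ?powR_ge0.
rewrite mulrAC ltr_pdivrMr ?powR_gt0// (lt_le_trans hq)//.
by rewrite -ler_pdivrMl// mulr1.
Qed.

(** An exponent above [s] with limit inferior [0] only increases the weights
    [q ^ s], so the values at [s] fall below [1] infinitely often. Together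
    with [irr_type_ge] this determines the type from [approximable]. *)
Lemma lt_irr_type (a : irrationals R) s :
  (s%:E < irr_type a)%E -> approximable s (set_val a).
Proof.
move=> /ereal_sup_gt [_ [th /= h <-]]; rewrite lte_fin => sth N.
have u0 q : 0 <= q%:R `^ th * dist_int (q%:R * set_val a).
  by rewrite mulr_ge0 ?powR_ge0 ?dist_int_ge0.
have [q Nq hq] := (limn_einf_eq0 u0).1 h 1 N ltr01.
exists q; split=> //.
have q1 : 1 <= q%:R :> R by rewrite ler1n (leq_ltn_trans _ Nq).
have q0 : 0 < q%:R :> R by rewrite (lt_le_trans ltr01).
have [|p hp] := @dist_int_lt _ (q%:R * set_val a) (q%:R `^ th)^-1.
  by rewrite -[X in _ < X]mulr1 ltr_pdivlMl// powR_gt0.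
exists p; apply: le_lt_trans (_ : q%:R `^ th * `|q%:R * set_val a - p%:~R| < 1).
  by rewrite ler_wpM2r// ler_powR// ltW.
by rewrite -ltr_pdivlMl ?powR_gt0// mulr1.
Qed.

Lemma open_approximable_beyond (s : R) N :
  open (set_val @^-1` approximable_beyond s N : set (irrationals R)).
Proof.
apply: open_comp => [x _|]; first exact: initial_continuous.
rewrite (_ : approximable_beyond s N =
    \bigcup_(x in [set x : nat * int | (N < x.1)%N])
      [set a : R | x.1%:R `^ s * `|x.1%:R * a - x.2%:~R| < 1]); last first.
  apply/seteqP; split=> [a [q [Nq [p hp]]]|a [[q p] /= Nq hp]].
    by exists (q, p).
  by exists q; split=> //; exists p.
apply: bigcup_open => -[q p] _ /=.
apply: (@open_comp _ _ (fun a : R => q%:R `^ s * `|q%:R * a - p%:~R|)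
  [set y | y < 1]); last exact: open_lt.
move=> x _; apply: cvgM; first exact: cvg_cst.
apply: cvg_norm; apply: cvgB; last exact: cvg_cst.
by apply: cvgM; [exact: cvg_cst|exact: cvg_id].
Qed.

Lemma irr_type_geP (a : irrationals R) (t : R) :
  (t%:E <= irr_type a)%E <->
  forall k : nat, approximable (t - k.+1%:R^-1) (set_val a).
Proof.
split=> [ta k|h].
  apply: lt_irr_type; apply: lt_le_trans ta.
  by rewrite lte_fin ltrBlDr ltrDl invr_gt0.
apply/lee_subgt0Pr => e e0; have [k ke] := exists_invn_lt e0.
apply: le_trans (irr_type_ge (h k)).
by rewrite -EFinB lee_fin lerD2l lerN2 ltW.
Qed.

Lemma irr_type_gtP (a : irrationals R) (t : R) :
  (t%:E < irr_type a)%E <->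
  exists k : nat, approximable (t + k.+1%:R^-1) (set_val a).
Proof.
split=> [/ereal_sup_gt[_ [s /= + <-]] ts|[k /irr_type_ge]]; last first.
  by apply: lt_le_trans; rewrite lte_fin ltrDl invr_gt0.
rewrite lte_fin -subr_gt0 in ts; have [k ke] := exists_invn_lt ts.
move=> h; exists k; apply: lt_irr_type.
apply: (@lt_le_trans _ _ s%:E); first by rewrite lte_fin -ltrBrDl.
by apply: ereal_sup_ubound; exists s.
Qed.

Lemma irr_type_infP (a : irrationals R) :
  irr_type a = +oo%E <-> forall k : nat, approximable k%:R (set_val a).
Proof.
split=> [ta k|h]; first by apply: lt_irr_type; rewrite ta ltry.
apply/eqyP => A A0; pose k := (Num.truncn A).+1.
apply: le_trans (irr_type_ge (h k)).
by rewrite lee_fin ltW// truncnS_gt.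
Qed.

End IrrationalityType.

(** * Irrational numbers with prescribed approximation exponents *)

Section UnimodularChain.
Variables (R : realType) (p : nat -> int) (q : nat -> nat).
Hypothesis q0 : q 0%N = 1%N.
Hypothesis q_double : forall n, (2 * q n <= q n.+1)%N.
Hypothesis unimodular : forall n,
  `|p n.+1 * (q n)%:Z - p n * (q n.+1)%:Z| = 1.

Let c n : R := (p n)%:~R / (q n)%:R.
Let e n : R := 4 / 3 / ((q n)%:R * (q n.+1)%:R).

(** The real number [chain_limit] is the common point of the nested intervals
    of radius [e n] around the fractions [c n], obtained as the supremum of the
    left end points. *)
Definition chain_limit : R := sup (range (fun n => c n - e n)).

Lemma den_expn n : (2 ^ n <= q n)%N.
Proof.
elim: n => [|n IH]; first by rewrite q0.
by rewrite expnS (leq_trans _ (q_double n))// leq_mul2l IH.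
Qed.

Lemma den_gt0 n : (0 < q n)%N.
Proof. by rewrite (leq_trans _ (den_expn n))// expn_gt0. Qed.

Lemma den_gt n : (n < q n)%N.
Proof. by rewrite (leq_trans (ltn_expl n (ltnSn 1)))// den_expn. Qed.

Lemma den_mono : {homo q : m n / (m <= n)%N}.
Proof.
apply: homo_leq => [//|y x z|n]; first exact: leq_trans.
by rewrite (leq_trans _ (q_double n))// leq_pmull.
Qed.

Let qR_gt0 n : 0 < (q n)%:R :> R.
Proof. by rewrite ltr0n den_gt0. Qed.

Let qR_double n : 2 * (q n)%:R <= (q n.+1)%:R :> R.
Proof. by rewrite -natrM ler_nat. Qed.

Lemma convergent_step n :
  `|c n.+1 - c n| = ((q n)%:R * (q n.+1)%:R)^-1.
Proof.
have -> : c n.+1 - c n =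
    (p n.+1 * (q n)%:Z - p n * (q n.+1)%:Z)%:~R / ((q n)%:R * (q n.+1)%:R).
  rewrite /c rmorphB !rmorphM/= -!pmulrn.
  by field; rewrite !gt_eqF.
by rewrite normrM -intr_norm unimodular mul1r normfV ger0_norm.
Qed.

(** Steps shrink by a factor [4] at least because denominators double, and
    [e n] is the step number [n] times [4 / 3 = 1 + 1/4 + 1/16 + ...]. This is
    the nesting of the intervals. *)
Lemma error_step n : `|c n.+1 - c n| + e n.+1 <= e n.
Proof.
rewrite convergent_step /e.
have h1 := qR_double n; have h2 := qR_double n.+1.
have a0 := qR_gt0 n; have b0 := qR_gt0 n.+1; have d0 := qR_gt0 n.+2.
set a := (q n)%:R in h1 a0 *; set b := (q n.+1)%:R in h1 h2 b0 *.
set d := (q n.+2)%:R in h2 d0 *.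
have : (b * d)^-1 <= (4 * (a * b))^-1.
  by rewrite lef_pV2 ?posrE ?mulr_gt0//; nra.
rewrite [(4 * _)^-1]invfM.
set X := (b * d)^-1; set Y := (a * b)^-1; lra.
Qed.

Lemma error_nested n k : `|c (n + k)%N - c n| + e (n + k)%N <= e n.
Proof.
elim: k => [|k IH]; first by rewrite addn0 subrr normr0 add0r.
rewrite addnS; have h := error_step (n + k).
have := ler_normD (c (n + k).+1 - c (n + k)%N) (c (n + k)%N - c n).
rewrite addrA subrK; lra.
Qed.

Lemma convergent_bracket m n : c m - e m <= c n + e n.
Proof.
have [mn|/ltnW nm] := leqP m n.
  have := error_nested m (n - m); rewrite subnKC// => h.
  have := ler_norm (c n - c m); have := ler_norm (- (c n - c m)); rewrite normrN.
  have : 0 <= e n by rewrite /e divr_ge0 ?mulr_ge0// ?divr_ge0.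
  lra.
have := error_nested n (m - n); rewrite subnKC// => h.
have := ler_norm (c m - c n); have := ler_norm (- (c m - c n)); rewrite normrN.
have : 0 <= e m by rewrite /e divr_ge0 ?mulr_ge0// ?divr_ge0.
lra.
Qed.

Lemma chain_limit_error n : `|chain_limit - c n| <= e n.
Proof.
rewrite ler_distl; apply/andP; split.
  apply: ub_le_sup; last by exists n.
  by exists (c 0%N + e 0%N) => _ [m _ <-]; exact: convergent_bracket.
apply: ge_sup; first by exists (c n - e n), n.
by move=> _ [m _ <-]; exact: convergent_bracket.
Qed.

Lemma chain_limit_geometric n : `|chain_limit - c n| <= (2 ^ n)%:R^-1.
Proof.
apply: le_trans (chain_limit_error n) _; rewrite /e.
have h1 := qR_double n; have a0 := qR_gt0 n; have b0 := qR_gt0 n.+1.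
rewrite (@le_trans _ _ ((q n)%:R^-1))//; last first.
  by rewrite lef_pV2 ?posrE ?ltr0n ?expn_gt0// ?ler_nat ?den_expn ?den_gt0.
rewrite ler_pdivrMr ?mulr_gt0// mulrA mulVf ?gt_eqF// mul1r.
have : 1 <= (q n)%:R :> R by rewrite ler1n den_gt0.
lra.
Qed.

Lemma scaled_error n : (q n)%:R * e n = 4 / 3 / (q n.+1)%:R.
Proof. by rewrite /e; field; rewrite !gt_eqF. Qed.

Lemma chain_limit_good n :
  `|(q n)%:R * chain_limit - (p n)%:~R| <= 4 / 3 / (q n.+1)%:R.
Proof.
have -> : (q n)%:R * chain_limit - (p n)%:~R = (q n)%:R * (chain_limit - c n).
  by rewrite /c; field; rewrite gt_eqF.
rewrite normrM ger0_norm//.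
by rewrite -scaled_error ler_wpM2l// chain_limit_error.
Qed.

(** If [m * p n = l * q n], then multiplying the unimodularity relation by [m]
    exhibits [m], up to sign, as a multiple of [q n]. *)
Lemma convergent_lowest_terms n (m : nat) (l : int) : (0 < m < q n)%N ->
  1 <= `|m%:Z * p n - l * (q n)%:Z|.
Proof.
move=> /andP[m0 mq]; rewrite -gtz0_ge1 normr_gt0 subr_eq0; apply/negP => /eqP E.
have : `|m%:Z * (p n.+1 * (q n)%:Z - p n * (q n.+1)%:Z)| = m%:Z.
  by rewrite normrM unimodular mulr1.
rewrite mulrBr [m%:Z * (p n * _)]mulrA E.
have -> : m%:Z * (p n.+1 * (q n)%:Z) - l * (q n)%:Z * (q n.+1)%:Z
   = (q n)%:Z * (m%:Z * p n.+1 - l * (q n.+1)%:Z) by ring.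
set K := (m%:Z * p n.+1 - _); rewrite normrM => H.
have K1 : 1 <= `|K|.
  rewrite -gtz0_ge1 normr_gt0; apply/eqP => K0; move: H.
  rewrite K0 normr0 mulr0; lia.
nia.
Qed.

(** Only the denominators [q n] approximate well: a fraction [l / m] with
    [m < q n] differs from [c n], so it is at distance at least
    [1 / (m * q n)] from it, whereas the limit is much closer to [c n]. This
    plays the part of the best approximation law of continued fractions, at the
    cost of a factor [3]. *)
Lemma chain_limit_bad n (m : nat) (l : int) : (0 < m < q n)%N ->
  (3 * (q n)%:R)^-1 <= `|m%:R * chain_limit - l%:~R|.
Proof.
move=> mq; have /andP[m0 mltq] := mq.
have a0 := qR_gt0 n; have b0 := qR_gt0 n.+1; have h1 := qR_double n.
have low : (q n)%:R^-1 <= `|m%:R * c n - l%:~R|.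
  have -> : m%:R * c n - l%:~R = (m%:Z * p n - l * (q n)%:Z)%:~R / (q n)%:R.
    rewrite /c rmorphB !rmorphM/= -!pmulrn; by field; rewrite gt_eqF.
  rewrite normrM normfV (ger0_norm (ltW a0)) ler_pdivlMr// mulVf ?gt_eqF//.
  by rewrite -intr_norm (ler_int _ 1) convergent_lowest_terms.
have up : `|m%:R * c n - m%:R * chain_limit| <= 2 / 3 * (q n)%:R^-1.
  rewrite -mulrBr normrM distrC ger0_norm//.
  apply: (@le_trans _ _ ((q n)%:R * e n)).
    by rewrite ler_pM// ?chain_limit_error// ler_nat ltnW.
  by rewrite scaled_error ler_pdivrMr// mulrAC ler_pdivlMr//; lra.
rewrite invfM.
have := ler_distD (m%:R * chain_limit) (m%:R * c n) l%:~R.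
move: low up; set X := (q n)%:R^-1; lra.
Qed.

Lemma chain_limit_irrational : irrational chain_limit.
Proof.
move=> [r _ rE].
have [m dE] : exists m : nat, denq r = m%:Z by exists `|denq r|%N; rewrite gez0_abs.
have m0 : (0 < m)%N by have := denq_gt0 r; lia.
have /(chain_limit_bad (numq r)) : (0 < m < q m)%N by rewrite m0 den_gt.
rewrite -rE /ratr dE -pmulrn mulrCA divff ?pnatr_eq0 -?lt0n// mulr1 subrr normr0.
by rewrite leNgt invr_gt0 mulr_gt0.
Qed.

(** From here on the growth of the denominators is prescribed by exponents
    [w]: then [w n] is the quality, as an exponent, of the approximation with
    denominator [q n]. *)
Variable w : nat -> R.
Hypothesis w_ge1 : forall n, 1 <= w n.
Hypothesis den_growth : forall n,
  2 * (q n)%:R `^ w n <= (q n.+1)%:R <= 4 * (q n)%:R `^ w n.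

Lemma chain_limit_approximable s :
  (forall N, exists2 n, (N <= n)%N & s <= w n) -> approximable s chain_limit.
Proof.
move=> h N; have [n Nn sw] := h N.
exists (q n); split; first by rewrite (leq_ltn_trans Nn)// den_gt.
exists (p n).
apply: (@le_lt_trans _ _ ((q n)%:R `^ w n * (4 / 3 / (q n.+1)%:R))).
  rewrite ler_pM// ?powR_ge0// ?chain_limit_good//.
  by rewrite ler_powR// ler1n den_gt0.
have /andP[h1 _] := den_growth n.
rewrite mulrA ltr_pdivrMr// mul1r.
have := powR_gt0 (w n) (qR_gt0 n); lra.
Qed.

(** A denominator [m] with [q k <= m < q k.+1] satisfies, by [chain_limit_bad],
    [m ^ t * |m x - l| >= (q k) ^ t / (3 * q k.+1) >= (q k) ^ (t - s) / 12],
    and this is at least [1] once [k] is large. *)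
Lemma chain_limit_not_approximable s t n0 : s < t ->
  (forall n, (n0 <= n)%N -> w n <= s) -> ~ approximable t chain_limit.
Proof.
move=> st ws h; pose n1 := (Num.truncn (12 `^ (t - s)^-1 : R)).+1.
(* From [n1] on, [(q k) ^ (t - s)] is at least [12 = 3 * 4]. *)
have [m [Nm [l]]] := h (q (maxn n0 n1)); apply/negP; rewrite -leNgt.
have ts0 : 0 < t - s by rewrite subr_gt0.
have [k /andP[nk mk]] : exists k, (maxn n0 n1 <= k)%N && (q k <= m < q k.+1)%N.
  have ex : exists k, (m < q k)%N by exists m; exact: den_gt.
  case: (ex_minnP ex) => -[|k] mk kmin.
    by move: mk; rewrite q0 ltnS leqn0 => /eqP m0; rewrite m0 in Nm.
  exists k; rewrite mk andbT; apply/andP; split.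
    rewrite leqNgt; apply/negP => /den_mono /(leq_trans mk)/(ltn_trans Nm).
    by rewrite ltnn.
  by rewrite leqNgt; apply/negP => /kmin; rewrite ltnn.
have /andP[n0k n1k] : (n0 <= k)%N && (n1 <= k)%N by rewrite -geq_max.
case/andP: mk => km mk.
have wk := ws _ n0k.
have t0 : 0 <= t by have := w_ge1 k; lra.
have q1 : 1 <= (q k)%:R :> R by rewrite ler1n den_gt0.
have big : 12 <= (q k)%:R `^ (t - s).
  have : 12 `^ (t - s)^-1 <= (q k)%:R :> R.
    rewrite ltW// (lt_le_trans (truncnS_gt _))// ler_nat -/n1.
    by rewrite (leq_trans n1k)// ltnW// den_gt.
  move/(ge0_ler_powR (ltW ts0)); rewrite !nnegrE powR_ge0 ler0n => /(_ isT isT).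
  by rewrite -powRrM mulVf ?gt_eqF// powRr1.
have m0 : (0 < m)%N by rewrite (leq_trans _ km)// den_gt0.
have low : (3 * (q k.+1)%:R)^-1 <= `|m%:R * chain_limit - l%:~R|.
  by apply: chain_limit_bad; rewrite m0 mk.
apply: (@le_trans _ _ ((q k)%:R `^ t * (3 * (q k.+1)%:R)^-1)); last first.
  apply: ler_pM => //; rewrite ?powR_ge0 ?invr_ge0 ?mulr_ge0//.
  by rewrite ge0_ler_powR ?nnegrE ?ler0n ?ler_nat.
rewrite ler_pdivlMr ?mulr_gt0// mul1r.
have /andP[_ h2] := den_growth k.
have h3 : (q k)%:R `^ w k <= (q k)%:R `^ s by rewrite ler_powR.
have -> : t = (t - s) + s by rewrite subrK.
rewrite powRD; last by rewrite (gt_eqF (qR_gt0 k)) implybT.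
have := ler_wpM2r (powR_ge0 (q k)%:R s) big; lra.
Qed.

End UnimodularChain.

Section Construction.
Variable R : realType.
Implicit Types w v : nat -> R.

(** The pair of the fractions number [n - 1] and [n], each given by numerator
    and denominator, starting from [1/0] and [0/1]. The partial quotient is
    chosen so that the next denominator is comparable with [x.2 ^ w m], where
    [x] is the current fraction. *)
Fixpoint convergents w n : (int * nat) * (int * nat) :=
  if n is m.+1 then
    let: (u, x) := convergents w m in
    let a := (Num.truncn (2 * x.2%:R `^ (w m - 1))).+1 in
    (x, (a%:Z * x.1 + u.1, (a * x.2 + u.2)%N))
  else ((1, 0%N), (0, 1%N)).

Definition num w n := (convergents w n).2.1.
Definition den w n := (convergents w n).2.2.

Definition real_of_exponents w : R := chain_limit R (num w) (den w).

Lemma convergents_local w v n : (forall i, (i < n)%N -> w i = v i) ->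
  convergents w n = convergents v n.
Proof.
elim: n => //= n IH h.
by rewrite IH ?h// => i ni; apply: h; rewrite ltnW.
Qed.

Section WithExponents.
Variable w : nat -> R.
Hypothesis w_ge1 : forall n, 1 <= w n.

Lemma den0 : den w 0 = 1%N. Proof. by []. Qed.

Lemma convergents_unimodular n : let: (u, x) := convergents w n in
  `|x.1 * u.2%:Z - u.1 * x.2%:Z| = 1.
Proof.
elim: n => //= n; case: (convergents w n) => u x /= IH.
set a := _.+1.
have -> : (a%:Z * x.1 + u.1) * x.2%:Z - x.1 * (a * x.2 + u.2)%N%:Z =
  - (x.1 * u.2%:Z - u.1 * x.2%:Z) by rewrite PoszD PoszM; ring.
by rewrite normrN.
Qed.

Lemma num_den_unimodular n :
  `|num w n.+1 * (den w n)%:Z - num w n * (den w n.+1)%:Z| = 1.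
Proof.
have := convergents_unimodular n.+1.
by rewrite /num /den/=; case: (convergents w n) => u x.
Qed.

Lemma convergents_den n : let: (u, x) := convergents w n in
  (u.2 <= x.2)%N && (0 < x.2)%N.
Proof.
elim: n => //= n; case: (convergents w n) => u x /= /andP[_ x0].
by set a := Num.truncn _; rewrite mulSn; nia.
Qed.

Lemma den_pos n : (0 < den w n)%N.
Proof.
by have := convergents_den n; rewrite /den; case: convergents => u x /andP[].
Qed.

Lemma den_step n : exists a b : nat, [/\ (b <= den w n)%N,
  den w n.+1 = (a * den w n + b)%N &
  2 * (den w n)%:R `^ (w n - 1) <= a%:R <= 2 * (den w n)%:R `^ (w n - 1) + 1].
Proof.
have := convergents_den n; rewrite /den /=.
case: (convergents w n) => u x /= /andP[ux x0].
exists (Num.truncn (2 * x.2%:R `^ (w n - 1)) ).+1, u.2; split => //.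
rewrite ltW ?truncnS_gt//= -natr1 lerD2r.
by rewrite truncn_le// mulr_ge0 ?powR_ge0.
Qed.

Lemma powR_pred n :
  (den w n)%:R `^ w n = (den w n)%:R * (den w n)%:R `^ (w n - 1) :> R.
Proof.
have d0 : 0 < (den w n)%:R :> R by rewrite ltr0n den_pos.
rewrite -[X in X * _](powRr1 (ltW d0)) -powRD ?(gt_eqF d0) ?implybT//.
by congr (_ `^ _); ring.
Qed.

Lemma powR_pred_ge1 n : 1 <= (den w n)%:R `^ (w n - 1) :> R.
Proof.
rewrite -[leLHS](powRr0 (den w n)%:R) ler_powR ?subr_ge0//.
by rewrite ler1n den_pos.
Qed.

Lemma den_double n : (2 * den w n <= den w n.+1)%N.
Proof.
have [a [b [_ -> /andP[h _]]]] := den_step n.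
have : 2 <= a%:R :> R by have := powR_pred_ge1 n; lra.
rewrite (ler_nat _ 2) => a2.
by rewrite (leq_trans _ (leq_addr _ _))// leq_mul2r a2 orbT.
Qed.

Lemma den_powR n :
  2 * (den w n)%:R `^ w n <= (den w n.+1)%:R <= 4 * (den w n)%:R `^ w n.
Proof.
have [a [b [bd -> /andP[h1 h2]]]] := den_step n.
have g := powR_pred_ge1 n.
rewrite powR_pred natrD natrM.
have d0 : 0 < (den w n)%:R :> R by rewrite ltr0n den_pos.
have b0 : 0 <= b%:R :> R by [].
have : b%:R <= (den w n)%:R :> R by rewrite ler_nat.
by move: d0 b0 h1 h2 g; set d := (den w n)%:R; set P := _ `^ _ => *; nra.
Qed.

Lemma real_of_exponents_irrational : irrational (real_of_exponents w).
Proof.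
exact: (chain_limit_irrational den0 den_double num_den_unimodular).
Qed.

Lemma real_of_exponents_approximable s :
  (forall N, exists2 n, (N <= n)%N & s <= w n) ->
  approximable s (real_of_exponents w).
Proof.
exact: (chain_limit_approximable den0 den_double num_den_unimodular den_powR).
Qed.

Lemma real_of_exponents_not_approximable s t n0 : s < t ->
  (forall n, (n0 <= n)%N -> w n <= s) -> ~ approximable t (real_of_exponents w).
Proof.
exact: (chain_limit_not_approximable den0 den_double num_den_unimodular
  w_ge1 den_powR).
Qed.

Lemma real_of_exponents_error n :
  `|real_of_exponents w - (num w n)%:~R / (den w n)%:R| <= (2 ^ n)%:R^-1.
Proof.
exact: (chain_limit_geometric R den0 den_double num_den_unimodular).
Qed.

End WithExponents.

(** The first [n] exponents determine the fraction number [n], hence the limit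
    up to [2 / 2 ^ n]. *)
Lemma real_of_exponents_local w v n :
  (forall i, 1 <= w i) -> (forall i, 1 <= v i) ->
  (forall i, (i < n)%N -> w i = v i) ->
  `|real_of_exponents w - real_of_exponents v| <= 2 / (2 ^ n)%:R.
Proof.
move=> w1 v1 wv.
have hw := real_of_exponents_error w1 n.
have := real_of_exponents_error v1 n.
rewrite /num /den -(convergents_local wv) -/(num w n) -/(den w n) distrC => hv.
rewrite mulr_natl mulr2n.
exact: le_trans (ler_distD _ _ _) (lerD hw hv).
Qed.

Lemma continuous_real_of_exponents (X : topologicalType) (W : X -> nat -> R) :
  (forall x i, 1 <= W x i) ->
  (forall i x, \forall y \near x, W y i = W x i) ->
  continuous (fun x => real_of_exponents (W x)).
Proof.
move=> W1 Wloc x; apply/cvgrPdist_le => e e0.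
pose n := Num.truncn (2 / e).
have small : 2 / (2 ^ n)%:R <= e.
  rewrite ler_pdivrMr ?ltr0n ?expn_gt0// mulrC -ler_pdivrMr//.
  by rewrite ltW// (lt_le_trans (truncnS_gt _))// ler_nat ltn_expl.
apply: filterS (near_forall_lt n (Wloc ^~ x)) => y yx.
by apply: le_trans small; apply: real_of_exponents_local => // i /yx.
Qed.

End Construction.

(** * Finite levels of the Borel hierarchy over a clopen base *)

Section Hierarchy.
Variable T : topologicalType.
Implicit Types A B U F : set T.

Lemma Sigma0_1 A : Sigma0 1 A -> open A.
Proof.
move=> h; have := erefl 1%N; move: h; move: {1 3}1%N => n h.
by case: n A / h => // n m F + _ _ E; rewrite -E.
Qed.

Lemma Sigma0_S n A : Sigma0 n.+2 A -> exists (m : nat -> nat) (F : nat -> set T),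
  [/\ forall i, (0 < m i < n.+2)%N, forall i, Sigma0 (m i) (~` F i) &
      A = \bigcup_i F i].
Proof.
move=> h; have := erefl n.+2; move: h; move: {1 3}n.+2 => k h.
case: k A / h => // k m F _ mk hF E; rewrite -E in mk.
by exists m, F.
Qed.

(** The natural numbers that code no index receive the empty set, whose
    complement is open. *)
Lemma Sigma0_countable_bigcup (I : countType) n (m : I -> nat)
    (F : I -> set T) :
  (1 < n)%N -> (forall i, (0 < m i < n)%N) ->
  (forall i, Sigma0 (m i) (~` F i)) -> Sigma0 n (\bigcup_i F i).
Proof.
move=> n1 mn hF.
pose G k := if unpickle k is Some i then F i else set0.
have -> : \bigcup_i F i = \bigcup_k G k.
  apply/seteqP; split=> [x [i _ Fx]|x [k _]].
    by exists (pickle i); rewrite // /G pickleK.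
  by rewrite /G; case: unpickle => // i Fx; exists i.
apply: (@Sigma0_bigcup _ _
  (fun k => if unpickle k is Some i then m i else 1%N)) => //.
  by move=> k; case: unpickle.
move=> k; rewrite /G; case: unpickle => [i|]; first exact: hF.
by rewrite setC0; constructor; exact: openT.
Qed.

Lemma Sigma0_2_setC_bigcap (U : nat -> set T) : (forall i, open (U i)) ->
  Sigma0 2 (~` \bigcap_i U i).
Proof.
move=> oU; rewrite setC_bigcap.
apply: (@Sigma0_bigcup _ _ (fun=> 1%N)) => // i.
by rewrite setCK; constructor.
Qed.

End Hierarchy.

Lemma Sigma0_preimage (S T : topologicalType) (f : S -> T) n (A : set T) :
  continuous f -> Sigma0 n A -> Sigma0 n (f @^-1` A).
Proof.
move=> cf; elim=> [U oU|k m F k1 mk _ IH].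
  by constructor; apply: open_comp => // x _; exact: cf.
rewrite preimage_bigcup; exact: (Sigma0_bigcup k1 mk).
Qed.

Section ClopenBase.
Variable X : topologicalType.

(** Countability of the base is what makes the reductions work: a point is read
    through countably many yes-or-no questions, each of which has a locally
    constant answer. *)
Definition clopen_base (V : nat -> set X) :=
  (forall i, clopen (V i)) /\
  (forall (U : set X) x, open U -> U x -> exists i, V i x /\ V i `<=` U).

Lemma open_clopen_base V (U : set X) : clopen_base V -> open U ->
  U = \bigcup_(i in [set i | V i `<=` U]) V i.
Proof.
move=> [_ hV] oU; apply/seteqP; split=> [x Ux|x [i /= VU /VU]//].
by have [i [Vx VU]] := hV _ _ oU Ux; exists i.
Qed.

(** Over a countable clopen base each set of the third additive class has this
    form, with the [C i k j] clopen. *)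
Definition sigma3 (C : nat -> nat -> nat -> set X) : set X :=
  \bigcup_i \bigcap_k \bigcup_j C i k j.

(** Members of the base switched on or off by [b], so that a sequence of
    booleans is a code of the open set [\bigcup_j coded V b j]. *)
Definition coded (V : nat -> set X) (b : nat -> bool) j :=
  if b j then V j else set0.

Lemma open_coded V (U : set X) : clopen_base V -> open U ->
  exists b : nat -> bool, U = \bigcup_j coded V b j.
Proof.
move=> bV oU; exists (fun j => `[< V j `<=` U >]).
rewrite [LHS](open_clopen_base bV oU); apply/seteqP; split=> x [j].
  by move=> /= VU Vx; exists j; rewrite // /coded; case: asboolP.
by rewrite /coded; case: asboolP => // VU _ Vx; exists j.
Qed.

(** Closed sets have to be written as countable intersections of open sets too:
    the complement of a closed set is a union of members of the base, and these
    have open complements. *)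
Lemma Sigma0_lt3_setC_Gdelta V m (F : set X) : clopen_base V ->
  (0 < m < 3)%N -> Sigma0 m (~` F) ->
  exists2 U : nat -> set X, (forall k, open (U k)) & F = \bigcap_k U k.
Proof.
move=> bV; case: m => [|[|[|]]]// _.
  move=> /Sigma0_1 /(open_coded bV) [b Fb].
  exists (fun k => ~` coded V b k) => [k|].
    apply: closed_openC; rewrite /coded; case: ifP => _; last exact: closed0.
    by case: (bV.1 k).
  by rewrite -setC_bigcup -Fb setCK.
move=> /Sigma0_S [m [G [m2 hG FG]]]; exists (fun k => ~` G k) => [k|].
  by apply: Sigma0_1; have := hG k; have := m2 k; case: (m k) => [|[|]].
by rewrite -setC_bigcup -FG setCK.
Qed.

Lemma Sigma0_3_coded V (A : set X) : clopen_base V -> Sigma0 3 A ->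
  exists b : nat -> nat -> nat -> bool, A = sigma3 (fun i k => coded V (b i k)).
Proof.
move=> bV /Sigma0_S [m [F [m3 hF ->]]].
have /choice[b bE] : forall i, exists b : nat -> nat -> bool,
    F i = \bigcap_k \bigcup_j coded V (b k) j.
  move=> i; have [U oU ->] := Sigma0_lt3_setC_Gdelta bV (m3 i) (hF i).
  have /choice[b bE] := fun k => open_coded bV (oU k).
  by exists b; apply: eq_bigcapr => k _; rewrite -bE.
by exists b; apply: eq_bigcupr => i _; rewrite -bE.
Qed.

Lemma Sigma0_3_sigma3 V (A : set X) : clopen_base V -> Sigma0 3 A ->
  exists2 C : nat -> nat -> nat -> set X,
    (forall i k j, clopen (C i k j)) & A = sigma3 C.
Proof.
move=> bV /(Sigma0_3_coded bV)[b ->]; eexists; last by [].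
move=> i k j; rewrite /coded; case: ifP => _; first exact: bV.1.
exact: clopen0.
Qed.

Lemma Pi0_2_bigcap_clopen V (A : set X) : clopen_base V -> Pi0 2 A ->
  exists2 C : nat -> nat -> set X,
    (forall k j, clopen (C k j)) & A = \bigcap_k \bigcup_j C k j.
Proof.
move=> bV /(Sigma0_lt3_setC_Gdelta bV)-/(_ isT)[U oU ->].
have /choice[b bE] := fun k => open_coded bV (oU k).
exists (fun k => coded V (b k)).
  move=> k j; rewrite /coded; case: ifP => _; first exact: bV.1.
  exact: clopen0.
by apply: eq_bigcapr => k _; rewrite -bE.
Qed.

End ClopenBase.

Lemma clopen_locally_constant (X : topologicalType) (C : set X) x : clopen C ->
  \forall y \near x, (y \in C) = (x \in C).
Proof.
move=> [oC cC]; have [Cx|nCx] := pselect (C x).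
  apply: filterS (open_nbhs_nbhs (conj oC Cx)) => y Cy.
  by rewrite !mem_set.
apply: filterS (open_nbhs_nbhs (conj (closed_openC cC) nCx)) => y nCy.
by rewrite !memNset.
Qed.

(** * Counting confirmed conditions *)

Section Progress.
Variable X : topologicalType.
Implicit Types C : nat -> nat -> set X.

(** The number of initial conditions [x \in \bigcup_j C k j] that the first [n]
    tests confirm. It depends on finitely many clopen conditions on [x], and it
    is unbounded in [n] exactly when all conditions hold. *)
Definition progress C x n :=
  find (fun k => ~~ has (fun j => x \in C k j) (iota 0 n)) (iota 0 n).

Lemma leq_progress C x n b : (b <= progress C x n)%N <->
  (b <= n)%N /\ forall k, (k < b)%N -> exists2 j, (j < n)%N & C k j x.
Proof.
rewrite /progress; set a := (fun k => _); split=> [bp|[bn h]].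
  have bn : (b <= n)%N by rewrite (leq_trans bp)// -[leqRHS](size_iota 0) find_size.
  split=> // k kb; have := before_find 0%N (leq_trans kb bp).
  rewrite nth_iota ?(leq_trans kb)// add0n /a => /negbFE/hasP[j].
  by rewrite mem_iota => /= jn /set_mem; exists j.
rewrite leqNgt -has_take_leq ?size_iota//; apply/hasPn => k.
rewrite take_iota (minn_idPl bn) mem_iota /a negbK => /= /h[j jn Cx].
by apply/hasP; exists j; [rewrite mem_iota | exact/mem_set].
Qed.

Lemma progress_mono C x : {homo progress C x : m n / (m <= n)%N}.
Proof.
move=> m n mn; apply/leq_progress.
have [pm h] := (leq_progress C x m _).1 (leqnn _).
split=> [|k /h[j jm Cx]]; first exact: leq_trans pm mn.
by exists j; rewrite // (leq_trans jm).
Qed.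

Lemma progress_unbounded C x :
  (\bigcap_k \bigcup_j C k j) x <-> forall b, exists n, (b <= progress C x n)%N.
Proof.
split=> [h b|h k _]; last first.
  have [n /leq_progress[_ /(_ k (ltnSn _)) [j _ Cx]]] := h k.+1.
  by exists j.
suff [n hn] : exists n, forall k, (k < b)%N -> exists2 j, (j < n)%N & C k j x.
  exists (maxn b n); apply/leq_progress; split=> [|k /hn[j jn Cx]].
    exact: leq_maxl.
  by exists j; rewrite // (leq_trans jn)// leq_maxr.
elim: b => [|b [n hn]]; first by exists 0%N.
have [j _ Cj] := h b I; exists (maxn n j.+1) => k.
rewrite ltnS leq_eqVlt => /orP[/eqP ->|/hn[i ni Ci]].
  by exists j; rewrite // leq_maxr.
by exists i; rewrite // (leq_trans ni)// leq_maxl.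
Qed.

Lemma unbounded_increases (g : nat -> nat) : {homo g : m n / (m <= n)%N} ->
  (forall b, exists n, (b <= g n)%N) <->
  (forall N, exists2 n, (N <= n)%N & (g n < g n.+1)%N).
Proof.
move=> gm; split=> [h N|h b].
  apply: contrapT => nh; have [n] := h (g N).+1; apply/negP; rewrite -ltnNge ltnS.
  have [nN|/ltnW Nn] := leqP n N; first exact: gm.
  elim: n Nn => [|n IH]; first by rewrite leqn0 => /eqP ->.
  rewrite leq_eqVlt => /orP[/eqP ->//|Nn].
  apply: leq_trans (IH Nn); rewrite leqNgt; apply/negP => lt.
  by apply: nh; exists n.
elim: b => [|b [n bn]]; first by exists 0%N.
have [k nk gk] := h n; exists k.+1.
by rewrite (leq_ltn_trans _ gk)// (leq_trans bn)// gm.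
Qed.

Lemma progress_locally_constant C n x : (forall k j, clopen (C k j)) ->
  \forall y \near x, progress C y n = progress C x n.
Proof.
move=> clC; have := near_forall_lt n (fun k => near_forall_lt n
  (fun j => clopen_locally_constant x (clC k j))).
apply: filterS => y yx; rewrite /progress; apply: eq_in_find => k.
rewrite mem_iota => /= kn; congr (~~ _); apply: eq_in_has => j.
by rewrite mem_iota => /= jn; rewrite yx.
Qed.

Implicit Types D : nat -> nat -> nat -> set X.

(** At time [n], the least index below [n] at which a progress is made between
    [n] and [n.+1], and [n] itself if there is none. It tends to infinity with
    [n] exactly when every progress is bounded. *)
Definition active D x n :=
  find (fun i => progress (D i) x n < progress (D i) x n.+1)%N (iota 0 n).

(** If index [i] progresses infinitely often, then [active] is at most [i] at
    those times, once [n > i]. Conversely, if each of the indices [0, ..., i]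
    stops progressing, then [active] eventually exceeds [i]. *)
Lemma active_infinitely_often D x : sigma3 D x <->
  exists i, forall N, exists2 n, (N <= n)%N & (active D x n <= i)%N.
Proof.
split=> [[i _ /progress_unbounded]|[i h]].
  move=> /(unbounded_increases (@progress_mono (D i) x)) h.
  exists i => N; have [n + lt] := h (maxn N i.+1).
  rewrite geq_max => /andP[Nn ni]; exists n => //.
  rewrite -ltnS -has_take_leq ?size_iota//; apply/hasP; exists i => //.
  by rewrite take_iota (minn_idPl ni) mem_iota add0n leq0n ltnSn.
apply: contrapT => nD.
have quiet k : exists N, forall n, (N <= n)%N ->
    ~~ (progress (D k) x n < progress (D k) x n.+1)%N.
  apply: contrapT => nq; apply: nD; exists k => //.
  apply/progress_unbounded/(unbounded_increases (@progress_mono (D k) x)) => N.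
  apply: contrapT => nN; apply: nq; exists N => n Nn; apply/negP => lt.
  by apply: nN; exists n.
have /choice[N hN] := quiet.
have [n] := h (maxn i.+1 (\max_(k < i.+1) N k)).
rewrite geq_max => /andP[ni Nn]; rewrite -ltnS -has_take_leq ?size_iota//.
rewrite take_iota (minn_idPl ni) => /hasP[k]; rewrite mem_iota => /= ki.
apply/negP/hN; apply: leq_trans Nn.
exact: (@leq_bigmax _ (fun k : 'I_i.+1 => N k) (Ordinal ki)).
Qed.

Lemma active_locally_constant D n x : (forall i k j, clopen (D i k j)) ->
  \forall y \near x, active D y n = active D x n.
Proof.
move=> clD.
have h m := near_forall_lt n (fun i => progress_locally_constant m x (clD i)).
apply: filterS2 (h n) (h n.+1) => y y1 y2; apply: eq_in_find => i.
by rewrite mem_iota => /= ni; rewrite y1// y2.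
Qed.

End Progress.

(** * Clopen bases of zero-dimensional Polish spaces *)

(** The balls with centre in a countable dense set and radius [1 / n.+1] form a
    countable family [ball_]. For each pair of such balls between which some
    clopen set lies, one is chosen; as clopen neighbourhoods are cofinal, these
    countably many clopen sets suffice. Indexing [ball_] by codes of centres also
    covers an empty dense set. *)
Lemma polish_clopen_base (R : realType) (X : topologicalType) :
  polish R X -> has_clopen_basis X -> exists V : nat -> set X, clopen_base V.
Proof.
move=> [[D /pcard_injP[code code_inj] dD] [M [f [g [fK gK cf cg _]]]]].
move=> [B [oB bB] clB].
pose ball_ (p : nat * nat) : set X := [set y | exists d,
  [/\ D d, code d = p.1 & ball (f d) p.2.+1%:R^-1 (f y)]].
have ballP (x : X) (U : set X) : nbhs x U -> exists p,
    nbhs x (ball_ p) /\ ball_ p `<=` U.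
  move=> xU.
  have /nbhs_ballP[e /= e0 eU] : nbhs (f x) (g @^-1` U).
    by apply: cg; rewrite fK.
  have [n ne] := exists_double_invn_le e0.
  have n0 : 0 < n.+1%:R :> R by [].
  have e20 : 0 < n.+1%:R^-1 / 2 :> R by rewrite divr_gt0 ?invr_gt0.
  pose O := (f @^-1` ball (f x) (n.+1%:R^-1 / 2))^°.
  have xO : nbhs x O.
    by apply: nbhs_interior; apply: cf; exact: nbhsx_ballx.
  have [d [Od Dd]] : O `&` D !=set0.
    by apply: dD; [exists x; exact: nbhs_singleton | exact: open_interior].
  have xd : ball (f x) (n.+1%:R^-1 / 2) (f d) by exact: (interior_subset Od).
  exists (code d, n); split=> [|y [d' /= [Dd' cd dy]]].
    apply: filterS xO => y /interior_subset /= xy; exists d; split=> //=.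
    by rewrite [n.+1%:R^-1]splitr; apply: ball_triangle xy; exact: ball_sym.
  have dd : d' = d by apply: code_inj; rewrite ?inE.
  rewrite -[y]fK; apply: eU; apply: (le_ball ne); apply: ball_triangle dy.
  rewrite dd; apply: le_ball xd.
  by rewrite ler_pdivrMr// ler_peMr ?invr_ge0// ler1n.
have /choice[V hV] : forall n : nat, exists C : set X, clopen C /\
    forall p1 p2, unpickle n = Some (p1, p2) ->
    (exists C', [/\ clopen C', ball_ p1 `<=` C' & C' `<=` ball_ p2]) ->
    ball_ p1 `<=` C /\ C `<=` ball_ p2.
  move=> n; case: (unpickle n) => [[p1 p2]|]; last first.
    by exists set0; split => //; exact: clopen0.
  have [[C [clC C1 C2]]|nC] := pselect
    (exists C', [/\ clopen C', ball_ p1 `<=` C' & C' `<=` ball_ p2]).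
    by exists C; split=> // _ _ [<- <-].
  by exists set0; split=> [|_ _ [<- <-] //]; exact: clopen0.
exists V; split=> [n|U x oU Ux]; first exact: (hV n).1.
have [p2 [xp2 p2U]] := ballP x U (open_nbhs_nbhs (conj oU Ux)).
have [C [BC Cx] Cp2] := bB x _ xp2.
have [p1 [xp1 p1C]] := ballP x C (open_nbhs_nbhs (conj (oB _ BC) Cx)).
exists (pickle (p1, p2)).
have [] := (hV (pickle (p1, p2))).2 p1 p2 (pickleK _).
  by exists C; split => //; exact: clB.
move=> h1 h2; split; first by apply: h1; exact: nbhs_singleton.
exact: subset_trans h2 p2U.
Qed.

(** * A diagonal set in the Cantor space *)

Definition cylinder (s : seq bool) : set cantor_space :=
  [set y | forall i, (i < size s)%N -> y i = nth false s i].

Lemma clopen_agree (b : nat -> bool) n :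
  clopen [set y : cantor_space | forall i, (i < n)%N -> y i = b i].
Proof.
elim: n => [|n IH].
  rewrite (_ : [set y | _] = setT); first exact: clopenT.
  by apply/seteqP; split.
rewrite (_ : [set y | _] =
    [set y | forall i, (i < n)%N -> y i = b i] `&` proj n @^-1` [set b n]).
  apply: clopenI => //; apply: preimage_clopen; last exact: proj_continuous.
  by split; [exact: discrete_open | exact: discrete_closed].
apply/seteqP; split=> [y h|y [h yn] i].
  by split=> [i ni|]; apply: h; rewrite // ltnW.
by rewrite ltnS leq_eqVlt => /orP[/eqP ->//|]; exact: h.
Qed.

(** The topology of the Cantor space is a supremum of initial topologies, so it
    is enough to see that the filter of the cylinders around [x] converges to
    [x] coordinate by coordinate. *)
Lemma cantor_clopen_base :
  clopen_base (fun n => if unpickle n is Some s then cylinder s else set0).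
Proof.
split=> [n|U x oU Ux].
  by case: unpickle => [s|]; [exact: clopen_agree | exact: clopen0].
pose F := filter_from [set: nat]
  (fun n => [set y : cantor_space | forall i, (i < n)%N -> y i = x i]).
have FF : Filter F.
  apply: filter_from_filter; first by exists 0%N.
  move=> m n _ _; exists (maxn m n) => // y h; split=> i im; apply: h.
    by rewrite (leq_trans im)// leq_maxl.
  by rewrite (leq_trans im)// leq_maxr.
have Fx : F --> (x : prod_topology (fun=> bool)).
  apply/cvg_sup => i A [B [[W oW <-] Wx WA]].
  by exists i.+1 => // y h; apply: WA; rewrite /= h.
have [n _ nU] := Fx _ (open_nbhs_nbhs (conj oU Ux)).
have sE i : (i < n)%N -> nth false (mkseq x n) i = x i by exact: nth_mkseq.
exists (pickle (mkseq x n)); rewrite pickleK; split=> [i|y h].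
  by rewrite size_mkseq => /sE.
by apply: nU => i ni; rewrite h ?size_mkseq ?sE.
Qed.

(** Cantor's diagonal argument: a point [y] is read as a code of a set of the
    third additive class, and [sigma3 C] consists of the [y] that belong to the
    set they code. A code of the complement of [sigma3 C] would belong to it
    exactly when it does not. *)
Lemma diagonal_not_Sigma0_3 (V : nat -> set cantor_space) : clopen_base V ->
  exists2 C : nat -> nat -> nat -> set cantor_space,
    (forall i k j, clopen (C i k j)) & ~ Sigma0 3 (~` sigma3 C).
Proof.
move=> bV; pose C (i k j : nat) :=
  [set y : cantor_space | y (pickle (i, k, j))] `&` V j.
exists C => [i k j|/(Sigma0_3_coded bV)[b bE]].
  apply: clopenI; last exact: bV.1.
  apply: (@preimage_clopen cantor_space bool (@proj nat (fun=> bool)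
    (pickle (i, k, j))) [set true]).
    by split; [exact: discrete_open | exact: discrete_closed].
  exact: proj_continuous.
pose y : cantor_space := fun n =>
  if unpickle n is Some (i, k, j) then b i k j else false.
have yC : sigma3 C y <-> sigma3 (fun i k => coded V (b i k)) y.
  have E i k j : C i k j y <-> coded V (b i k) j y.
    rewrite /C /coded /= /y pickleK; case: (b i k j) => //.
      by split=> [[]|].
    by split=> [[]|].
  by split=> -[i _ h]; exists i => // k /(h k)[j _ /E]; exists j.
have [nCC Cn] : ~ sigma3 C y <-> sigma3 C y.
  by rewrite -[~ _]/((~` sigma3 C) y) bE; exact: iff_sym.
have nC : ~ sigma3 C y by move=> yh; exact: (Cn yh yh).
exact: nC (nCC nC).
Qed.

(** * Borel class of the level sets of the type *)

Section LevelSets.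
Variable R : realType.

Let U (s : R) N : set (irrationals R) := set_val @^-1` approximable_beyond s N.

Let open_U s N : open (U s N). Proof. exact: open_approximable_beyond. Qed.

(** The complement consists of the countable intersections of open sets that
    make up [t < irr_type a], and of the closed sets that make up
    [irr_type a < t]; the two kinds have levels 2 and 1. *)
Lemma Pi0_3_irr_type_eq (t : R) :
  Pi0 3 [set a : irrationals R | irr_type a = t%:E].
Proof.
pose F (i : nat + nat * nat) := match i with
  | inl k => \bigcap_N U (t + k.+1%:R^-1) N
  | inr (k, N) => ~` U (t - k.+1%:R^-1) N end.
rewrite /Pi0 (_ : ~` _ = \bigcup_i F i).
  apply: (@Sigma0_countable_bigcup _ _ 3
    (fun i => if i is inl _ then 2 else 1)%N) => //; first by case.
  case=> [k|[k N]]; first exact: Sigma0_2_setC_bigcap.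
  by rewrite /F setCK; constructor.
apply/seteqP; split=> [a /= ta|a [[k|[k N]] _ /=]].
- have [lo|nlo] := pselect (t%:E <= irr_type a)%E.
    have /irr_type_gtP[k hk] : (t%:E < irr_type a)%E.
      by rewrite lt_neqAle lo andbT; apply/eqP => E; exact: ta.
    by exists (inl k) => // N _; exact: hk.
  have [k nk] : exists k : nat, ~ approximable (t - k.+1%:R^-1) (set_val a).
    by apply/existsNP => h; apply: nlo; exact/irr_type_geP.
  have [N nN] : exists N, ~ U (t - k.+1%:R^-1) N a by exact/existsNP.
  by exists (inr (k, N)).
- move=> h ta; have : (t%:E < irr_type a)%E.
    by apply/irr_type_gtP; exists k => N; exact: h.
  by rewrite ta ltxx.
- move=> nU ta; apply: nU.
  have /irr_type_geP/(_ k) : (t%:E <= irr_type a)%E by rewrite ta.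
  exact.
Qed.

Lemma Pi0_2_irr_type_inf : Pi0 2 [set a : irrationals R | irr_type a = +oo%E].
Proof.
rewrite /Pi0 (_ : ~` _ = \bigcup_(i : nat * nat) ~` U i.1%:R i.2).
  apply: (@Sigma0_countable_bigcup _ _ 2 (fun=> 1%N)) => // i.
  by rewrite setCK; constructor.
rewrite -setC_bigcap; congr (~` _); apply/seteqP; split=> [a /=|a h /=].
  by move=> /irr_type_infP h [k N] _; exact: h.
by apply/irr_type_infP => k N; exact: (h (k, N) I).
Qed.

End LevelSets.

(** * Continuous reductions to the level sets *)

Section Reduction.
Variable R : realType.

Definition irrational_of_exponents (w : nat -> R) (w1 : forall n, 1 <= w n) :
    irrationals R :=
  exist _ (real_of_exponents w) (mem_set (real_of_exponents_irrational w1)).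

Lemma continuous_irrational_of_exponents (X : topologicalType)
    (W : X -> nat -> R) (W1 : forall x n, 1 <= W x n) :
  (forall n x, \forall y \near x, W y n = W x n) ->
  continuous (fun x => irrational_of_exponents (W1 x)).
Proof.
move=> hW; apply: continuous_comp_initial.
exact: continuous_real_of_exponents.
Qed.

Lemma irr_type_exponents_ge w (w1 : forall n, 1 <= w n) s :
  (forall N, exists2 n, (N <= n)%N & s <= w n) ->
  (s%:E <= irr_type (irrational_of_exponents w1))%E.
Proof.
by move=> h; apply: irr_type_ge; exact: real_of_exponents_approximable.
Qed.

Lemma irr_type_exponents_le w (w1 : forall n, 1 <= w n) s n0 :
  (forall n, (n0 <= n)%N -> w n <= s) ->
  (irr_type (irrational_of_exponents w1) <= s%:E)%E.
Proof.
move=> h; rewrite leNgt; apply/negP => /irr_type_gtP[k].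
by apply: real_of_exponents_not_approximable h => //; rewrite ltrDl invr_gt0.
Qed.

Variable X : topologicalType.

(** The exponents are the progress of [x], which is nondecreasing: the type is
    infinite exactly when they are unbounded. *)
Lemma reduction_inf (C : nat -> nat -> set X) : (forall k j, clopen (C k j)) ->
  exists2 f : X -> irrationals R, continuous f &
    f @^-1` [set a | irr_type a = +oo%E] = \bigcap_k \bigcup_j C k j.
Proof.
move=> clC; pose W x n : R := (progress C x n).+1%:R.
have W1 x n : 1 <= W x n by rewrite ler1n.
exists (fun x => irrational_of_exponents (W1 x)).
  apply: continuous_irrational_of_exponents => n x.
  by apply: filterS (progress_locally_constant n x clC) => y; rewrite /W => ->.
apply/seteqP; split=> x.
  move=> /= tx; apply: contrapT => /progress_unbounded/existsNP[b nb].
  have : (irr_type (irrational_of_exponents (W1 x)) <= b%:R%:E)%E.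
    apply: (@irr_type_exponents_le _ _ _ 0%N) => n _; rewrite ler_nat ltnNge.
    by apply/negP => bn; apply: nb; exists n.
  by rewrite tx leye_eq.
move=> /progress_unbounded h; apply/eqyP => A A0.
apply: irr_type_exponents_ge => N; have [n bn] := h (Num.truncn A).
exists (maxn N n); first exact: leq_maxl.
rewrite ltW// (lt_le_trans (truncnS_gt _))// ler_nat ltnS (leq_trans bn)//.
by rewrite progress_mono// leq_maxr.
Qed.

(** The exponents [t + 1 / (i + 1)], with [i] the active index, have upper limit
    [t] if the active index tends to infinity. If it does not, some value [i]
    bounds it infinitely often and the type is at least [t + 1 / (i + 1)]. *)
Lemma reduction_finite (t : R) (C : nat -> nat -> nat -> set X) : 1 <= t ->
  (forall i k j, clopen (C i k j)) ->
  exists2 f : X -> irrationals R, continuous f &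
    f @^-1` [set a | irr_type a = t%:E] = ~` sigma3 C.
Proof.
move=> t1 clC; pose W x n : R := t + (active C x n).+1%:R^-1.
have tW x n : t <= W x n by rewrite lerDl invr_ge0.
have W1 x n : 1 <= W x n by exact: le_trans (tW x n).
exists (fun x => irrational_of_exponents (W1 x)).
  apply: continuous_irrational_of_exponents => n x.
  by apply: filterS (active_locally_constant n x clC) => y; rewrite /W => ->.
apply/seteqP; split=> x.
  move=> /= tx /active_infinitely_often[i h].
  have : ((t + i.+1%:R^-1)%:E <= irr_type (irrational_of_exponents (W1 x)))%E.
    apply: irr_type_exponents_ge => N; have [n Nn ni] := h N; exists n => //.
    by rewrite lerD2l lef_pV2 ?posrE// ler_nat.
  by rewrite tx lee_fin gerDl leNgt invr_gt0 ltr0Sn.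
move=> nC; apply/eqP; rewrite eq_le; apply/andP; split; last first.
  by apply: irr_type_exponents_ge => N; exists N.
apply/lee_addgt0Pr => e e0; have [i ie] := exists_invn_lt e0; rewrite -EFinD.
have [N hN] : exists N, forall n, (N <= n)%N -> (i < active C x n)%N.
  apply: contrapT => nN; apply: nC; apply/active_infinitely_often.
  exists i => N; apply: contrapT => nn; apply: nN; exists N => n Nn.
  by rewrite ltnNge; apply/negP => ni; apply: nn; exists n.
apply: (@irr_type_exponents_le _ _ _ N) => n /hN ni.
rewrite lerD2l; apply: le_trans (ltW ie).
by rewrite lef_pV2 ?posrE// ler_nat leqW.
Qed.

End Reduction.

Theorem theorem1p3 (R : realType) :
  (forall t : R, 1 <= t ->
     class_complete R (Pi0 3) [set a : irrationals R | irr_type a = t%:E] /\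
     (Pi0 3 [set a : irrationals R | irr_type a = t%:E] /\
      ~ Sigma0 3 [set a : irrationals R | irr_type a = t%:E])) /\
  class_complete R (Pi0 2) [set a : irrationals R | irr_type a = +oo%E].
Proof.
split=> [t t1|]; last first.
  split=> [|X pX zX A]; first exact: Pi0_2_irr_type_inf.
  have [V bV] := polish_clopen_base pX zX.
  move=> /(Pi0_2_bigcap_clopen bV)[C clC ->]; exact: reduction_inf.
split; [split=> [|X pX zX A] | split]; try exact: Pi0_3_irr_type_eq.
  have [V bV] := polish_clopen_base pX zX.
  move=> /(Sigma0_3_sigma3 bV)[C clC AC].
  by rewrite -[A]setCK AC; exact: reduction_finite.
have [C clC nC] := diagonal_not_Sigma0_3 cantor_clopen_base.
have [f cf fC] := reduction_finite t1 clC.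
by move=> /(Sigma0_preimage cf); rewrite fC.
Qed.
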